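(* Let $\{a,b,c\}$ with $a<b<c$ and $\{a',b',c'\}$ with $a'<b'<c'$ be $D(4)$-triples for which the associated triangles exist, and let these triangles have side-length triples $(r,s,t)$ and $(r',s',t')$, respectively. If the two triangles are similar, then they are congruent.
   Context: A $D(4)$-triple is a set of three distinct positive integers such that the product of any two distinct elements, increased by $4$, is a perfect square. For a $D(4)$-triple $\{a,b,c\}$ with $a<b<c$, put $r=\sqrt{ab+4}$, $s=\sqrt{ac+4}$, $t=\sqrt{bc+4}$; these are positive integers with $r<s<t$. If $r+s>t$, the (non-degenerate) triangle with side lengths $r,s,t$ is called the triangle associated with the $D(4)$-triple $\{a,b,c\}$, and $(r,s,t)$ is its side-length triple; if $r+s\le t$, the associated triangle does not exist. For $\{a',b',c'\}$ the quantities $r',s',t'$ are defined in the same way. *)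

(* Defs.v *)
From mathcomp Require Import all_boot all_order all_algebra all_fingroup.
From mathcomp Require Import reals.
Set Implicit Arguments.
Unset Strict Implicit.
Unset Printing Implicit Defensive.
Import Order.TTheory GRing.Theory Num.Theory.
Local Open Scope ring_scope.

Definition is_square (n : nat) : Prop := exists k : nat, n = (k ^ 2)%N.

Definition D4_triple (a b c : nat) : Prop :=
  [/\ [/\ (0 < a)%N, (0 < b)%N & (0 < c)%N],
      [/\ a != b, a != c & b != c] &
      [/\ is_square (a * b + 4), is_square (a * c + 4)
        & is_square (b * c + 4)]].

Definition side (R : realType) (x y : nat) : R := Num.sqrt (x * y + 4)%N%:R.

Definition assoc_triangle_exists (R : realType) (a b c : nat) : Prop :=
  side R b c < side R a b + side R a c.

(* The norm that the analysis library puts on 'rV[R]_2 is the sup norm, hence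
   an explicit Euclidean distance. *)
Definition edist (R : realType) (P Q : 'rV[R]_2) : R :=
  Num.sqrt (\sum_(i < 2) (P 0 i - Q 0 i) ^+ 2).

(* A triangle is given by its vertices; the order in which they are listed is
   forgotten by the permutation in [similar_triangles] and
   [congruent_triangles]. *)
Definition triangle (R : realType) : Type := 'I_3 -> 'rV[R]_2.

Definition has_side_lengths (R : realType) (T : triangle R) (r s t : R) : Prop :=
  [/\ edist (T 0) (T 1) = r, edist (T 1) (T 2) = s & edist (T 2) (T 0) = t].

Definition is_assoc_triangle (R : realType) (a b c : nat) (T : triangle R) :
    Prop :=
  has_side_lengths T (side R a b) (side R a c) (side R b c).

Definition is_similarity (R : realType) (k : R) (f : 'rV[R]_2 -> 'rV[R]_2) :
    Prop :=
  0 < k /\ forall P Q, edist (f P) (f Q) = k * edist P Q.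

Definition is_isometry (R : realType) (f : 'rV[R]_2 -> 'rV[R]_2) : Prop :=
  forall P Q, edist (f P) (f Q) = edist P Q.

Definition similar_triangles (R : realType) (T T' : triangle R) : Prop :=
  exists (k : R) (f : 'rV[R]_2 -> 'rV[R]_2) (sigma : 'S_3),
    is_similarity k f /\ forall i, f (T i) = T' (sigma i).

Definition congruent_triangles (R : realType) (T T' : triangle R) : Prop :=
  exists (f : 'rV[R]_2 -> 'rV[R]_2) (sigma : 'S_3),
    is_isometry f /\ forall i, f (T i) = T' (sigma i).

(* Main.v *)
Require Import Defs.
From mathcomp Require Import all_boot all_order all_algebra all_fingroup.
From mathcomp Require Import reals.
From mathcomp Require Import zify ring lra.

(** Put [x = (r s - a t) / 2], [y = (r t - b s) / 2] and
    [d = a + b + c + (a b c - r s t) / 2].  Then [a d + 4 = x ^ 2],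
    [b d + 4 = y ^ 2], [2 s = a y + r x], [2 t = b x + r y] and [0 <= d].
    If [d = 0], then [x = y = 2], so [s = a + r] and [t = b + r].  If [0 < d],
    then [x < y] and [2 (t - s) = (b x - a y) + r (y - x) >= 2 r], hence there
    is no triangle.  The sides of an associated triangle are thus
    [r], [a + r], [b + r], so a similarity of ratio [k] between two of them
    multiplies [a], [b] and [r] by [k], and [r ^ 2 - a b = 4] forces
    [k = 1]. *)

Set Implicit Arguments.
Unset Strict Implicit.
Unset Printing Implicit Defensive.
Import Order.TTheory GRing.Theory Num.Theory.
Local Open Scope ring_scope.

(** [u - v] and [u + v] have the same parity, so an odd [u - v] would make the difference of squares
    odd. *)
Lemma sub_even_of_sqr (u v m : int) :
  u ^+ 2 - v ^+ 2 = 2 * m -> exists n, u - v = 2 * n.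
Proof.
move=> uv_even; have [q [e [uvE e01]]] :
    exists q e : int, u - v = 2 * q + e /\ (e = 0 \/ e = 1).
  by exists ((u - v) %/ 2)%Z, ((u - v) %% 2)%Z; lia.
exists q; case: e01 => eE; first by rewrite uvE eE addr0.
have uE : u = v + 2 * q + 1 by lia.
have : 2 * (2 * q ^+ 2 + 2 * q + 2 * q * v + v - m) + 1 = 0.
  by move: uv_even; rewrite uE => /eqP; rewrite -subr_eq0 => /eqP <-; ring.
lia.
Qed.

Lemma ltr_of_sqr (u v : int) : 0 <= v -> u ^+ 2 < v ^+ 2 -> u < v.
Proof. by move=> ? ?; nia. Qed.

(** Integrality and sign come from comparing squares: [(r s) ^ 2 - (a t) ^ 2 = 4 (a b + a c + 4 - a
    ^ 2)] is even and positive, and similarly for [y]. *)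
Lemma D4_descent (a b c r s t : int) :
  0 < a -> a < b -> b < c -> 0 < r -> 0 < s -> 0 < t ->
  a * b + 4 = r ^+ 2 -> a * c + 4 = s ^+ 2 -> b * c + 4 = t ^+ 2 ->
  exists d x y : int,
    [/\ 0 <= d, 0 < x /\ 0 < y, a * d + 4 = x ^+ 2 /\ b * d + 4 = y ^+ 2 &
        2 * s = a * y + r * x /\ 2 * t = b * x + r * y].
Proof.
move=> a0 ab bc r0 s0 t0 hr hs ht.
have [x xE] : exists x, r * s - a * t = 2 * x.
  apply: (@sub_even_of_sqr _ _ (2 * (a * b + a * c + 4 - a ^+ 2))).
  by rewrite !exprMn -hr -hs -ht; ring.
have [y yE] : exists y, r * t - b * s = 2 * y.
  apply: (@sub_even_of_sqr _ _ (2 * (a * b + b * c + 4 - b ^+ 2))).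
  by rewrite !exprMn -hr -hs -ht; ring.
have [n nE] : exists n, a * b * c - r * s * t = 2 * n.
  apply: (@sub_even_of_sqr _ _ (- 2 * (a * b * c * (a + b + c)
    + 4 * (a * b + a * c + b * c) + 16))).
  by rewrite !exprMn -hr -hs -ht; ring.
have x0 : 0 < x.
  have : a * t < r * s; last by lia.
  by apply: ltr_of_sqr; [nia | rewrite !exprMn -hr -hs -ht; nia].
have y0 : 0 < y.
  have : b * s < r * t; last by lia.
  by apply: ltr_of_sqr; [nia | rewrite !exprMn -hr -hs -ht; nia].
pose d := a + b + c + n.
have dx : a * d + 4 = x ^+ 2.
  suff : 4 * (a * d + 4) = (2 * x) ^+ 2 by rewrite exprMn; lia.
  transitivity (4 * a * (a + b + c) + 2 * a * (2 * n) + 16).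
    by rewrite /d; ring.
  by rewrite -nE -xE sqrrB !exprMn -hr -hs -ht; ring.
have dy : b * d + 4 = y ^+ 2.
  suff : 4 * (b * d + 4) = (2 * y) ^+ 2 by rewrite exprMn; lia.
  transitivity (4 * b * (a + b + c) + 2 * b * (2 * n) + 16).
    by rewrite /d; ring.
  by rewrite -nE -yE sqrrB !exprMn -hr -hs -ht; ring.
exists d, x, y; split=> //; last split.
(* A negative [d] makes [x ^ 2] and [y ^ 2] less than 4, so [x = y = 1] and [a d = b d = - 3],
   against [a < b]. *)
- case: (lerP 0 d) => // d0.
  have x1 : x = 1 by nia.
  have y1 : y = 1 by nia.
  by subst x y; nia.
(* The terms in [a r t] cancel, leaving [s] times [r ^ 2 - a b = 4]. *)
- have : 2 * (2 * s) = a * (2 * y) + r * (2 * x); last by lia.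
  rewrite -xE -yE; transitivity ((r ^+ 2 - a * b) * s); last by ring.
  by rewrite -hr; ring.
- have : 2 * (2 * t) = b * (2 * x) + r * (2 * y); last by lia.
  rewrite -xE -yE; transitivity ((r ^+ 2 - a * b) * t); last by ring.
  by rewrite -hr; ring.
Qed.

(** By the formulas for [2 s] and [2 t] this is [r + s <= t]. A gap [y - x] of at least 2 already
    yields [2 r]; for a gap of 1, [b x - a y] must supply the second [r]. *)
Lemma D4_no_triangle (a b r d x y : int) :
  0 < a -> a < b -> 0 < r -> 0 < d -> 0 < x -> 0 < y ->
  a * b + 4 = r ^+ 2 -> a * d + 4 = x ^+ 2 -> b * d + 4 = y ^+ 2 ->
  2 * r + (a * y + r * x) <= b * x + r * y.
Proof.
move=> a0 ab r0 d0 x0 y0 hr hx hy.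
have xy : x < y by nia.
have [y1|y2] : y = x + 1 \/ x + 2 <= y by lia.
- (* Here [(b - a) d = 2 x + 1], and [r <= b x - a y] reduces to
     [d <= 2 x + 1]. *)
  subst y.
  have bad : (b - a) * d = 2 * x + 1.
    by rewrite mulrBl; move: hx hy; rewrite sqrrD; lia.
  have d_le : d <= 2 * x + 1 by nia.
  suff r_le : r <= b * x - a * (x + 1) by lia.
  (* Multiplying the bound by [d] removes [a] and [b]: its right side becomes [x ^ 2 + x + 4], and
     [(r d) ^ 2 = (a d) (b d) + 4 d ^ 2]. *)
  have rd_sq : (r * d) ^+ 2 <= (x ^+ 2 + x + 4) ^+ 2.
    have -> : (r * d) ^+ 2 = (x ^+ 2 - 4) * ((x + 1) ^+ 2 - 4) + 4 * d ^+ 2.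
      by rewrite exprMn -hr -hx -hy; ring.
    have d_sq : d ^+ 2 <= (2 * x + 1) ^+ 2 by nia.
    rewrite -subr_ge0; have -> : (x ^+ 2 + x + 4) ^+ 2 -
      ((x ^+ 2 - 4) * ((x + 1) ^+ 2 - 4) + 4 * d ^+ 2) =
      4 * ((2 * x + 1) ^+ 2 - d ^+ 2) by ring.
    by lia.
  rewrite -(ler_pM2r d0).
  suff : (b * x - a * (x + 1)) * d = x ^+ 2 + x + 4.
    have rd0 : 0 <= r * d by rewrite mulr_ge0 ?ltW.
    have u0 : 0 <= x ^+ 2 + x + 4.
      by rewrite !addr_ge0 ?sqr_ge0 ?(ltW x0).
    by move=> ->; rewrite -ler_sqr.
  transitivity ((b - a) * d * x - a * d); first by ring.
  by rewrite bad; move: hx; lia.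
(* The squares differ by [(b - a) (a b d + 4 (a + b))], which is positive. *)
have ayx : a * y < b * x.
  apply: ltr_of_sqr; first by nia.
  by rewrite !exprMn -hx -hy; nia.
nia.
Qed.

(** The conclusion amounts to [c = a + b + 2 r]: only regular triples have a triangle. *)
Lemma D4_triangle_regular (a b c r s t : nat) :
  (0 < a)%N -> (a < b)%N -> (b < c)%N ->
  (a * b + 4 = r ^ 2)%N -> (a * c + 4 = s ^ 2)%N -> (b * c + 4 = t ^ 2)%N ->
  (t < r + s)%N -> (s = a + r /\ t = b + r)%N.
Proof.
move=> a0 ab bc hr hs ht tri.
have [] := @D4_descent a b c r s t; try by nia.
move=> d [x] [y] [d0 [x0 y0] [hx hy] [sE tE]].
have [dE|dpos] : d = 0 \/ 0 < d by lia.
  have x2 : x = 2 by subst d; nia.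
  have y2 : y = 2 by subst d; nia.
  by subst x y; lia.
suff : 2 * r%:Z + (a%:Z * y + r%:Z * x) <= b%:Z * x + r%:Z * y by lia.
by apply: (@D4_no_triangle a b r d x y) => //; lia.
Qed.

Section Triangles.
Variable R : realType.

Lemma side_natr (x y r : nat) : (x * y + 4 = r ^ 2)%N -> side R x y = r%:R.
Proof. by move=> xyr; rewrite /side xyr natrX sqrtr_sqr ger0_norm. Qed.

Lemma assoc_triangle_sides (a b c : nat) :
  D4_triple a b c -> (a < b)%N -> (b < c)%N -> assoc_triangle_exists R a b c ->
  exists r : nat, [/\ (0 < a)%N, (a * b + 4 = r ^ 2)%N,
    side R a b = r%:R, side R a c = (a + r)%:R & side R b c = (b + r)%:R].
Proof.
move=> [[a0 _ _] _ [[r hr] [s hs] [t ht]]] ab bc.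
rewrite /assoc_triangle_exists (side_natr hr) (side_natr hs) (side_natr ht).
rewrite -natrD ltr_nat => tri.
have [sE tE] := D4_triangle_regular a0 ab bc hr hs ht tri.
by exists r; rewrite hr sE tE.
Qed.

Lemma edistC (P Q : 'rV[R]_2) : edist P Q = edist Q P.
Proof. by congr Num.sqrt; apply: eq_bigr => i _; rewrite -opprB sqrrN. Qed.

(** Scaling by [k > 0] preserves the strict order of the sides, so sides of equal rank correspond
    whatever the labelling of the vertices. *)
Lemma similar_sides (T T' : triangle R) (k : R) f (sigma : 'S_3)
    (r s t r' s' t' : R) :
  is_similarity k f -> (forall i, f (T i) = T' (sigma i)) ->
  has_side_lengths T r s t -> has_side_lengths T' r' s' t' ->
  r < s -> s < t -> r' < s' -> s' < t' ->
  [/\ r' = k * r, s' = k * s & t' = k * t].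
Proof.
move=> [k0 fk] fT [T01 T12 T20] [T01' T12' T20'] rs st rs' st'.
have krs : k * r < k * s by rewrite ltr_pM2l.
have kst : k * s < k * t by rewrite ltr_pM2l.
have := fk (T 0) (T 1); have := fk (T 1) (T 2); have := fk (T 2) (T 0).
rewrite !fT T01 T12 T20.
(* [sigma] may reverse the orientation of an edge, so each length is needed in both directions. *)
have T10' := T01'; have T21' := T12'; have T02' := T20'.
rewrite edistC in T10'; rewrite edistC in T21'; rewrite edistC in T02'.
have ne01 : sigma 0 != sigma 1 by rewrite (inj_eq perm_inj).
have ne12 : sigma 1 != sigma 2 by rewrite (inj_eq perm_inj).
have ne20 : sigma 2 != sigma 0 by rewrite (inj_eq perm_inj).
have I3 (i : 'I_3) : [\/ i = 0, i = 1 | i = 2].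
  by case: i => [[|[|[|//]]]] ?; [constructor 1|constructor 2|constructor 3];
     apply: val_inj.
move: ne01 ne12 ne20.
(* Injectivity leaves six assignments; all but the identity contradict the order of the sides. *)
case: (I3 (sigma 0)) => ->; case: (I3 (sigma 1)) => ->;
  case: (I3 (sigma 2)) => -> //= _ _ _;
  rewrite ?T01' ?T12' ?T20' ?T10' ?T21' ?T02' => *; split; lra.
Qed.

End Triangles.

Theorem proposition4p5 (R : realType) (a b c a' b' c' : nat)
    (T T' : triangle R)
    (habc : D4_triple a b c) (hab : (a < b)%N) (hbc : (b < c)%N)
    (habc' : D4_triple a' b' c') (hab' : (a' < b')%N) (hbc' : (b' < c')%N)
    (hex : assoc_triangle_exists R a b c)
    (hex' : assoc_triangle_exists R a' b' c')
    (hT : is_assoc_triangle a b c T)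
    (hT' : is_assoc_triangle a' b' c' T') :
  similar_triangles T T' -> congruent_triangles T T'.
Proof.
move=> [k [f [sigma [simf fT]]]].
have [r [a0 hr rE sE tE]] := assoc_triangle_sides habc hab hbc hex.
have [r' [a0' hr' rE' sE' tE']] := assoc_triangle_sides habc' hab' hbc' hex'.
move: hT hT'; rewrite /is_assoc_triangle rE sE tE rE' sE' tE' => hT hT'.
have [] := similar_sides simf fT hT hT'; rewrite ?ltr_nat; try by lia.
rewrite !natrD => kr ks kt.
have {}ks : a'%:R = k * a%:R by lra.
have {}kt : b'%:R = k * b%:R by lra.
have hrR : a%:R * b%:R + 4 = r%:R ^+ 2 :> R by rewrite -natrM -natrD hr natrX.
have : a'%:R * b'%:R + 4 = r'%:R ^+ 2 :> R by rewrite -natrM -natrD hr' natrX.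
(* The terms [k ^ 2 a b] cancel in [k2], leaving [4 = 4 k ^ 2]. *)
rewrite kr ks kt exprMn -hrR => k2.
have [k0 fk] := simf.
have k1 : k = 1.
  by apply/eqP; rewrite -(eqrXn2 (n := 2)) ?ltW// expr1n; apply/eqP; lra.
by exists f, sigma; split=> // P Q; rewrite fk k1 mul1r.
Qed.
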